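(* Let $P,q\in\mathbb C(z)$ be rational functions with $P$ non-constant and $q\not\equiv0$, and let $\gamma\subset\mathbb C$ be a curve containing no poles of $P$ or $q$. Suppose that $q^{-1}\{\infty\}\subseteq P^{-1}\{\infty\}$ (as subsets of $\mathbb{CP}^1$), $P(\infty)=\infty$, and $$\int_\gamma P^i(z)q(z)\,dz=0$$ for all $i\ge i_0$, where $i_0\ge0$. Then this equality holds for all $i\ge0$.
   Context: A curve is an oriented piecewise-smooth curve in $\mathbb C$ (closed or not) having only transversal self-intersections. *)

(* Defs.v *)
From HB Require Import structures.
From mathcomp Require Import all_boot all_order all_algebra.
From mathcomp Require Import generic_quotient complex.
From mathcomp Require Import all_classical all_reals all_analysis.
Set Implicit Arguments.
Unset Strict Implicit.
Unset Printing Implicit Defensive.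
Import Order.TTheory GRing.Theory Num.Theory.
Import numFieldNormedType.Exports.
Local Open Scope classical_set_scope.
Local Open Scope ring_scope.

(** Rational functions, as maps from the Riemann sphere to itself. *)

Notation ratfun R := {fraction {poly R[i]}}.

Notation CP1 R := (option R[i]).

Definition infty (R : realType) : CP1 R := None.
Arguments infty {R}.

Section Ratfun.
Variable R : realType.
Implicit Types f : ratfun R.

(* [repr f] is a fraction representing [f], not necessarily in lowest terms:
   [rnum f] and [rden f] are its numerator and denominator after reduction. *)
Definition rnum f : {poly R[i]} :=
  let r := repr f in r.1 %/ gcdp r.1 r.2.

Definition rden f : {poly R[i]} :=
  let r := repr f in r.2 %/ gcdp r.1 r.2.

(* At infinity, when [size n <= size d], the ratio of the coefficients of
   degree [deg d] is the limit of [n / d] (0 when [deg n < deg d]). *)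
Definition rat_eval f (x : CP1 R) : CP1 R :=
  let n := rnum f in
  let d := rden f in
  match x with
  | Some z => if root d z then infty else Some (n.[z] / d.[z])
  | None => if (size d < size n)%N then infty
            else Some (n`_(size d).-1 / lead_coef d)
  end.

(* The value of [f] at a complex number which is not a pole (0 at a pole). *)
Definition rat_val f (z : R[i]) : R[i] := odflt 0 (rat_eval f (Some z)).

End Ratfun.

(** Curves in the complex plane and integrals along them. *)

Section Curves.
Variable R : realType.
Implicit Types (g : R -> R[i]) (a b s t : R) (u v : R[i]).

Local Notation RE g := (fun t : R => complex.Re (g t)).
Local Notation IM g := (fun t : R => complex.Im (g t)).
Local Notation mu := (@lebesgue_measure R).

Definition velocity g t : R[i] := Complex (derive1 (RE g) t) (derive1 (IM g) t).

(* A regular arc of class C^1 on [a, b]: the velocity on ]a, b[ extends to a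
   continuous nowhere vanishing function on [a, b]. *)
Definition smooth_arc g a b : Prop :=
  [/\ derivable_oo_LRcontinuous (RE g) a b,
      derivable_oo_LRcontinuous (IM g) a b &
      exists w : R -> R[i],
        [/\ {within `[a, b], continuous (RE w)},
            {within `[a, b], continuous (IM w)},
            {in `]a, b[, velocity g =1 w} &
            forall t, t \in `[a, b] -> w t != 0]].

Definition piecewise_smooth g a b : Prop :=
  exists (n : nat) (x : nat -> R),
    [/\ x 0%N = a, x n = b &
        forall k, (k < n)%N -> x k < x k.+1 /\ smooth_arc g (x k) (x k.+1)].

Definition right_tangent g t v : Prop :=
  h^-1 * (complex.Re (g (t + h)) - complex.Re (g t)) @[h --> 0^'+]
    --> complex.Re v /\
  h^-1 * (complex.Im (g (t + h)) - complex.Im (g t)) @[h --> 0^'+]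
    --> complex.Im v.

Definition left_tangent g t v : Prop :=
  h^-1 * (complex.Re (g (t + h)) - complex.Re (g t)) @[h --> 0^'-]
    --> complex.Re v /\
  h^-1 * (complex.Im (g (t + h)) - complex.Im (g t)) @[h --> 0^'-]
    --> complex.Im v.

(* One-sided tangent vectors at [t] of the restriction of [g] to [a, b]. *)
Definition tangent g a b t v : Prop :=
  (t < b /\ right_tangent g t v) \/ (a < t /\ left_tangent g t v).

(* The two passages through a multiple point have tangent vectors that are
   linearly independent over [R]; at a corner this is asked of both one-sided
   tangents.  The coincidence [g a = g b] of the end points of a closed curve
   is not a self-intersection. *)
Definition transversal_self_intersections g a b : Prop :=
  forall s t, a <= s -> s < t -> t <= b -> g s = g t -> (s, t) <> (a, b) ->
  forall u v, tangent g a b s u -> tangent g a b t v ->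
  forall k : R, v <> Complex k 0 * u.

(* [g], restricted to [a, b], parametrizes the curve with its orientation. *)
Definition is_curve g a b : Prop :=
  [/\ a < b, piecewise_smooth g a b & transversal_self_intersections g a b].

Definition avoids_poles g a b (f : ratfun R) : Prop :=
  forall t, t \in `[a, b] -> rat_eval f (Some (g t)) <> infty.

Definition complex_integral a b (h : R -> R[i]) : R[i] :=
  Complex (\int[mu]_(t in `[a, b]) complex.Re (h t))
          (\int[mu]_(t in `[a, b]) complex.Im (h t)).

(* [velocity g] is meaningless at the finitely many corners of [g], which are
   negligible for the Lebesgue measure. *)
Definition contour_integral g a b (F : R[i] -> R[i]) : R[i] :=
  complex_integral a b (fun t => F (g t) * velocity g t).

End Curves.

(* Main.v *)
Require Import Defs.
From HB Require Import structures.
From mathcomp Require Import all_boot all_order all_algebra.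
From mathcomp Require Import generic_quotient complex.
From mathcomp Require Import all_classical all_reals all_analysis.
From mathcomp Require Import separable measurable_realfun.
From mathcomp Require Import ring zify.
Set Implicit Arguments.
Unset Strict Implicit.
Unset Printing Implicit Defensive.
Import Order.TTheory GRing.Theory Num.Theory.
Import numFieldNormedType.Exports.
Local Open Scope classical_set_scope.
Local Open Scope ring_scope.

(* Write P = n / d in lowest terms, q = u / d^k, x = P(z), and let A be the ring
   of the fractions p / d^m. Since deg n > deg d, A is generated over C[x] by the
   z^i / d with i < deg n. Let I : A -> C be the integral along the curve.
   Multiplying q by powers of P, it suffices to show that I(x^i y) = 0 for all
   i >= 1 implies I(y) = 0.
   There is eta in A with eta P' = a(P) P for a polynomial a, vanishing at the end
   points of the curve and having a simple zero at each zero of n. Put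
   D y = (eta y)'. Then I(D y) = 0, and D(x^i y) = x^i D y + i a(x) x^i y, so
   D - lambda preserves the condition I(x^i y) = 0 (i >= 1) and multiplies I(y)
   by - lambda. If y vanishes to order e at a zero z0 of n, then (D - lambda) y
   vanishes to order e + 1 for lambda = (e + 1) eta'(z0), which is nonzero.
   Iterating, if I(y) <> 0, then for each N there is f in A with I(x^N f) <> 0 but
   I(x^i f) = 0 for i > N. This contradicts the stationarity of the chain of
   C[x]-submodules T_N = {f | I(x^i f) = 0 for all i >= N} of A. *)

(** * Algebra *)

Section Noether.
Variable F : fieldType.
Implicit Types (p : {poly F}) (c : {poly {poly F}}).

(** A vector of [F[x]^r] is encoded as a polynomial of size at most [r], whose coefficients are its
    coordinates. Induction on [r]: the last coordinates met along the chain form an ideal, and a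
    nonzero one of minimal size, reached at some stage, divides all the others. *)
Lemma submodule_chain_stationary (M : nat -> {poly {poly F}} -> Prop) :
    (forall N, M N 0) ->
    (forall N c1 c2, M N c1 -> M N c2 -> M N (c1 + c2)) ->
    (forall N p c, M N c -> M N (p *: c)) ->
    (forall N N' c, (N <= N')%N -> M N c -> M N' c) ->
  forall r, exists N0, forall c N, (size c <= r)%N -> M N c -> M N0 c.
Proof.
move=> M0 MD MZ Mle; elim=> [|r [N1 IH]].
  by exists 0%N => c N; rewrite leqn0 size_poly_eq0 => /eqP ->.
pose lead k := exists N c, [/\ (size c <= r.+1)%N, M N c, c`_r != 0 & size c`_r = k].
(* If the last coordinate always vanishes, the stage [N1] given by rank [r] works unchanged. *)
have [[k0 lead0]|nolead] := pselect (exists k, lead k); last first.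
  exists N1 => c N sc Mc; apply: (IH c N) => //.
  rewrite leqNgt; apply/negP => sc'; apply: nolead; exists (size c`_r), N, c; split=> //.
  have cE : c`_r = lead_coef c.
    rewrite lead_coefE; congr (_`__); apply/esym/eqP.
    by rewrite -eqSS prednK ?eqn_leq ?sc // (leq_ltn_trans _ sc').
  by rewrite cE lead_coef_eq0 -size_poly_gt0 (leq_ltn_trans _ sc').
have ex_lead : exists k, `[< lead k >] by exists k0; apply/asboolP.
case: (ex_minnP ex_lead) => k /asboolP[N2 [c0 [sc0 Mc0 c0N0 kE]]] kmin.
exists (maxn N1 N2) => c N sc Mc.
pose c1 := c - (c`_r %/ c0`_r) *: c0.
have Mc1 : M (maxn N N2) c1.
  apply: MD; first by apply: (Mle N) => //; rewrite leq_maxl.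
  by rewrite -scaleNr; apply: MZ; apply: (Mle N2) => //; rewrite leq_maxr.
have c1r : c1`_r = c`_r %% c0`_r.
  by rewrite coefB coefZ {1}(divp_eq c`_r c0`_r) addrAC subrr add0r.
have sc1 : (size c1 <= r.+1)%N.
  rewrite (leq_trans (size_polyD _ _)) // geq_max sc size_polyN.
  exact: leq_trans (size_scale_leq _ _) sc0.
(* The last coordinate of [c1] is a remainder modulo that of [c0]; were it nonzero, it would
   contradict the minimality of [k]. *)
have c1r0 : c1`_r = 0.
  apply/eqP; apply: contraT => c1rN0.
  have lead1 : lead (size c1`_r) by exists (maxn N N2); exists c1.
  have /asboolP/kmin := lead1; by rewrite leqNgt c1r -kE ltn_modp c0N0.
have sc1' : (size c1 <= r)%N.
  apply/leq_sizeP => j; rewrite leq_eqVlt => /predU1P[<- //|rj].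
  by move/leq_sizeP: sc1; apply.
rewrite -[c](subrK ((c`_r %/ c0`_r) *: c0)); apply: MD.
  by apply: (Mle N1); [rewrite leq_maxl|exact: IH Mc1].
by apply: MZ; apply: (Mle N2) => //; rewrite leq_maxr.
Qed.

(** The linear functional on [F[x]] that sends ['X^l] to [sigma l]. *)
Definition coef_pairing (sigma : nat -> F) p : F := \sum_(l < size p) p`_l * sigma l.

Lemma coef_pairing_widen K sigma p : (size p <= K)%N ->
  coef_pairing sigma p = \sum_(l < K) p`_l * sigma l.
Proof.
move=> pK; rewrite /coef_pairing (big_ord_widen K (fun l => p`_l * sigma l)) //.
rewrite big_mkcond; apply: eq_bigr => l _; case: ltnP => // pl.
by rewrite nth_default // mul0r.
Qed.

Lemma coef_pairing0 sigma : coef_pairing sigma 0 = 0.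
Proof. by rewrite (@coef_pairing_widen 0) ?size_poly0 // big_ord0. Qed.

Lemma coef_pairingC sigma a : coef_pairing sigma a%:P = a * sigma 0%N.
Proof.
by rewrite (@coef_pairing_widen 1) ?size_polyC ?leq_b1 // big_ord1 coefC.
Qed.

Lemma coef_pairingD sigma p1 p2 :
  coef_pairing sigma (p1 + p2) = coef_pairing sigma p1 + coef_pairing sigma p2.
Proof.
pose K := maxn (size p1) (size p2).
rewrite !(@coef_pairing_widen K) ?leq_maxl ?leq_maxr ?size_polyD // -big_split.
by apply: eq_bigr => l _; rewrite coefD mulrDl.
Qed.

Lemma coef_pairingZ sigma a p :
  coef_pairing sigma (a *: p) = a * coef_pairing sigma p.
Proof.
rewrite !(@coef_pairing_widen (size p)) ?size_scale_leq // mulr_sumr.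
by apply: eq_bigr => l _; rewrite coefZ mulrA.
Qed.

Lemma coef_pairingXM sigma p :
  coef_pairing sigma ('X * p) = coef_pairing (fun l => sigma l.+1) p.
Proof.
have [->|p0] := eqVneq p 0; first by rewrite mulr0 !coef_pairing0.
rewrite {1}/coef_pairing mulrC size_mulX // big_ord_recl coefMX mul0r add0r.
by apply: eq_bigr => l _; rewrite coefMX.
Qed.

End Noether.

(** * Construction of the vector field [eta] *)

Section Denominators.
Variables (C : numClosedFieldType) (n d : {poly C}).
Hypothesis nd_coprime : coprimep n d.
Hypothesis size_dn : (size d < size n)%N.
Implicit Types (p w : {poly C}) (z : C).

(** Each root [z] of [w] is treated separately: if [d] vanishes at [z], a factor [d] absorbs it;
    otherwise [z] is a root of [n - c *: d] for [c = n(z) / d(z)], which is nonzero. *)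
Lemma dvd_norm w : w != 0 -> (forall z, root n z -> ~~ root w z) ->
  exists cs K, all (fun c => c != 0) cs /\ w %| \prod_(c <- cs) (n - c *: d) * d ^+ K.
Proof.
move=> w0 nw; have [zs wE] := closed_field_poly_normal w.
have {nw} : all (fun z => ~~ root n z) zs.
  apply/allP => z zzs; apply: contraTN isT => /nw.
  by rewrite wE rootZ ?lead_coef_eq0 // root_prod_XsubC zzs.
rewrite wE; under eq_exists do under eq_exists do rewrite dvdpZl ?lead_coef_eq0 //.
elim: zs {wE} => [_|z zs IH /= /andP[nz /IH[cs [K [cs0 dv]]]]].
  by exists [::], 0%N; rewrite !big_nil dvd1p.
rewrite big_cons; have [dz|dz] := boolP (root d z).
  exists cs, K.+1; split=> //; rewrite exprS mulrCA dvdp_mul //.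
  by rewrite dvdp_XsubCl.
exists (n.[z] / d.[z] :: cs), K; split.
  by rewrite /= cs0 mulf_neq0 ?invr_eq0.
rewrite big_cons -mulrA dvdp_mul // dvdp_XsubCl rootE.
by rewrite hornerD hornerN hornerZ divfK ?subrr.
Qed.

(* [eps / d ^+ t] is the field [eta] with [eta * P^`() = a(P) * P]. *)
Lemma simple_vector_field z1 z2 : ~~ root d z1 -> ~~ root d z2 ->
  exists eps cs K t, [/\ t.+1 = (size cs + K)%N,
    (n^`() * d - n * d^`()) * eps = n * (\prod_(c <- cs) (n - c *: d) * d ^+ K),
    root eps z1, root eps z2 &
    forall z, root n z -> root eps z /\ eps^`().[z] != 0].
Proof.
move=> dz1 dz2.
have n0 : n != 0 by rewrite -size_poly_gt0 (leq_ltn_trans _ size_dn).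
have root_d z : root n z -> ~~ root d z by apply: coprimep_root.
have d0 : d != 0 by apply: contraNneq dz1 => ->; rewrite root0.
(* The quotient [n1 = n / g] is the squarefree part of [n]; it will give [eps] its simple zeros. *)
pose g := gcdp n n^`().
have g0 : g != 0 by rewrite gcdp_eq0 (negPf n0).
have /dvdpP[n1 nE] : g %| n := dvdp_gcdl _ _.
have /dvdpP[n2 n'E] : g %| n^`() := dvdp_gcdr _ _.
have n10 : n1 != 0 by apply: contraNneq n0 => n10; rewrite nE n10 mul0r.
have n12 : coprimep n1 n2.
  have := @coprimep_div_gcd _ n n^`() .
  by rewrite n0 /= -/g {1}nE {1}n'E !mulpK //; apply.
have n1_sep : coprimep n1 n1^`().
  by have := make_separable n0; rewrite -/g {1}nE mulpK // unlock.
have root_n1 z : root n z = root n1 z.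
  apply/idP/idP => [nz|n1z]; last by rewrite nE rootM n1z.
  apply: contraT => n1z.
  have [e [v vz nve]] := multiplicity_XsubC n z.
  move: vz; rewrite n0 /= => vz.
  case: e nve => [|e] nve; first by rewrite nve mulr1 (negPf vz) in nz.
  (* If [n1] did not vanish at [z], the full power of ['X - z] in [n] would divide [g], hence the
     derivative of [n], which is impossible in characteristic zero. *)
  have : ('X - z%:P) ^+ e.+1 %| n^`().
    apply: dvdp_trans (dvdp_gcdr n _); rewrite -/g -(@Gauss_dvdpr _ _ n1) -?nE.
      by rewrite nve dvdp_mull.
    by rewrite coprimep_expl // coprimep_sym coprimep_XsubC.
  rewrite nve derivM deriv_exp derivXsubC mul1r exprS [_ * _ + _]addrC.
  rewrite dvdp_addl; last exact: dvdp_mull.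
  rewrite mulrnAr -mulrnAl /=.
  rewrite dvdp_mul2r ?expf_neq0 ?polyXsubC_eq0 // dvdp_XsubCl rootE hornerMn.
  by rewrite mulrn_eq0 /= -rootE (negPf vz).
have dn1 z : root n z -> n1^`().[z] != 0.
  by rewrite root_n1; apply: coprimep_root.
(* The numerator of the derivative of [n / d], divided by [g]; this removes its zeros at the roots
   of [n]. *)
pose w1 := n2 * d - n1 * d^`().
have w1z z : root n z -> ~~ root w1 z.
  move=> nz; have := nz; rewrite root_n1 => n1z.
  rewrite rootE hornerD hornerN !hornerM (rootP n1z) mul0r subr0.
  by rewrite mulf_neq0 ?root_d //; apply: coprimep_root n1z.
have w10 : w1 != 0.
  have [|z nz] := closed_rootP n _.
    by rewrite neq_ltn (leq_ltn_trans _ size_dn) ?orbT // size_poly_gt0.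
  by apply: contraNneq (w1z z nz) => ->; rewrite root0.
have [cs [K [cs0 w1dvd]]] := dvd_norm w10 w1z.
have {w1dvd} /dvdpP[f0 f0E] := w1dvd.
(* An end point which is not a zero of [n] needs a factor [n - c *: d] vanishing there; at a zero of
   [n], the factor [n1] already vanishes. *)
pose cend z := if root n z then [::] else [:: n.[z] / d.[z]].
have cend_neq0 z : ~~ root d z -> all (fun c => c != 0) (cend z).
  by rewrite /cend => dz; case: ifPn => //= nz; rewrite andbT mulf_neq0 ?invr_eq0.
have cend_root z : ~~ root d z -> root (n1 * \prod_(c <- cend z) (n - c *: d)) z.
  rewrite rootM -root_n1 /cend; case: ifP => //= nz dz.
  by rewrite big_seq1 rootE hornerD hornerN hornerZ divfK ?subrr.
pose cs' := cend z1 ++ cend z2 ++ cs.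
pose norm_ s := \prod_(c <- s) (n - c *: d).
have norm_cat s s' : norm_ (s ++ s') = norm_ s * norm_ s' by exact: big_cat.
(* The last factor [d] makes the exponent of [d] positive, so that [t] can be a natural number. *)
pose f1 := norm_ (cend z1) * norm_ (cend z2) * f0 * d.
have f1E : f1 * w1 = norm_ cs' * d ^+ K.+1.
  transitivity (norm_ (cend z1) * norm_ (cend z2) * (f0 * w1) * d).
    by rewrite /f1; ring.
  by rewrite -f0E !norm_cat exprSr -/(norm_ cs); ring.
have f1z z : root n z -> ~~ root f1 z.
  move=> nz; have : ~~ root (f1 * w1) z; last by rewrite rootM; case/norP.
  rewrite f1E rootM negb_or /root horner_exp expf_neq0 ?root_d // andbT.
  rewrite horner_prod prodf_seq_neq0; apply/allP => c cE /=.
  rewrite hornerD hornerN hornerZ (rootP nz) add0r oppr_eq0 mulf_neq0 ?root_d //.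
  have : all (fun c => c != 0) cs' by rewrite !all_cat !cend_neq0.
  by move/allP; apply.
exists (n1 * f1), cs', K.+1, (size cs' + K)%N; split.
- by rewrite addnS.
- rewrite -/(norm_ cs') -f1E {1}n'E {1 2}nE /w1; ring.
- have -> : n1 * f1 = norm_ (cend z2) * f0 * d * (n1 * norm_ (cend z1)).
    by rewrite /f1; ring.
  by rewrite rootM cend_root ?orbT.
- have -> : n1 * f1 = norm_ (cend z1) * f0 * d * (n1 * norm_ (cend z2)).
    by rewrite /f1; ring.
  by rewrite rootM cend_root ?orbT.
move=> z nz; split; first by rewrite rootM -root_n1 nz.
rewrite derivM hornerD [(n1^`() * f1).[z]]hornerM [(n1 * _).[z]]hornerM.
have := nz; rewrite root_n1 => /rootP ->; rewrite mul0r addr0.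
by apply: mulf_neq0; [exact: dn1 | exact: f1z].
Qed.

End Denominators.

(** * Moments of fractions whose denominator is a power of [d] *)

Section Moments.
Variables (C : numClosedFieldType) (n d : {poly C}).
Hypothesis nd_coprime : coprimep n d.
Hypothesis size_dn : (size d < size n)%N.
Variables (z1 z2 : C).
Implicit Types (p q s u v : {poly C}) (c : {poly {poly C}}).
Hypothesis dz1 : ~~ root d z1.
Hypothesis dz2 : ~~ root d z2.
(* [J m p] stands for the integral of [p / d ^+ m]. *)
Variable J : nat -> {poly C} -> C.
Hypothesis J_linear : forall m (a : C) (p q : {poly C}),
  J m (a *: p + q) = a * J m p + J m q.
Hypothesis J_den : forall m (p : {poly C}), J m.+1 (p * d) = J m p.
Hypothesis J_exact : forall m (p : {poly C}), p.[z1] = 0 -> p.[z2] = 0 ->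
  J m.+1 (p^`() * d - (p * d^`()) *+ m) = 0.

Let J0 m : J m 0 = 0.
Proof. by have := J_linear m (-1) 0 0; rewrite scaler0 addr0 mulN1r addNr. Qed.

Let JD m p q : J m (p + q) = J m p + J m q.
Proof. by rewrite -[p]scale1r J_linear mul1r scale1r. Qed.

Let JZ m a p : J m (a *: p) = a * J m p.
Proof. by rewrite -[a *: p]addr0 J_linear J0 addr0. Qed.

Let JB m p q : J m (p - q) = J m p - J m q.
Proof. by rewrite JD -scaleN1r JZ mulN1r. Qed.

Let JMn m p i : J m (p *+ i) = J m p *+ i.
Proof. by rewrite -scaler_nat JZ mulr_natl. Qed.

Let J_sum m r (f : 'I_r -> {poly C}) : J m (\sum_(i < r) f i) = \sum_(i < r) J m (f i).
Proof. by elim/big_rec2: _ => [|i x y _ <-]; rewrite ?J0 ?JD. Qed.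

Let J_denX m p k : J (m + k) (p * d ^+ k) = J m p.
Proof.
elim: k => [|k IH]; first by rewrite addn0 expr0 mulr1.
by rewrite addnS exprSr mulrA J_den.
Qed.

Let r := (size n).-1.

Let size_nE : size n = r.+1.
Proof. by rewrite prednK // (leq_ltn_trans _ size_dn). Qed.

Let n_neq0 : n != 0. Proof. by rewrite -size_poly_gt0 size_nE. Qed.

(** With [x = n / d], this is the integral of [x^j y], where [y] is the sum of the [c_i(x) 'X^i / d]
    for [i < r]. *)
Let moment (c : {poly {poly C}}) j :=
  \sum_(i < r) coef_pairing (fun l => J (j + l).+1 (n ^+ (j + l) * 'X^i)) c`_i.

Let momentD c1 c2 j : moment (c1 + c2) j = moment c1 j + moment c2 j.
Proof.
by rewrite -big_split; apply: eq_bigr => i _; rewrite coefD coef_pairingD.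
Qed.

Let momentZ a c j : moment (a%:P *: c) j = a * moment c j.
Proof.
by rewrite mulr_sumr; apply: eq_bigr => i _; rewrite coefZ mul_polyC coef_pairingZ.
Qed.

Let momentXZ c j : moment ('X *: c) j = moment c j.+1.
Proof.
apply: eq_bigr => i _; rewrite coefZ coef_pairingXM.
by congr coef_pairing; apply/funext => l; rewrite addnS.
Qed.

(** Multiplying [c] by the variable [x] shifts the moments by one, so the conditions at stage [N]
    define a [C[x]]-submodule. *)
Lemma moment_stationary : exists N0, forall (c : {poly {poly C}}) N, (size c <= r)%N ->
  (forall j, (N <= j)%N -> moment c j = 0) -> forall j, (N0 <= j)%N -> moment c j = 0.
Proof.
apply: (@submodule_chain_stationary _ (fun N c => forall j, (N <= j)%N -> moment c j = 0)).
- by move=> N j _; rewrite /moment big1 // => i _; rewrite coef0 coef_pairing0.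
- by move=> N c1 c2 h1 h2 j Nj; rewrite momentD h1 ?h2 ?addr0.
- move=> N p c hc; elim/poly_ind: p => [|p a IH] j Nj.
    by rewrite scale0r /moment big1 // => i _; rewrite coef0 coef_pairing0.
  rewrite scalerDl momentD momentZ hc // mulr0 addr0 mulrC -scalerA momentXZ.
  by rewrite IH // (leq_trans Nj).
- by move=> N N' c NN' hc j N'j; rewrite hc // (leq_trans NN').
Qed.

(* [p / d ^+ m] is a combination of the ['X^i / d], [i < r], over the
   polynomials in [n / d]. *)
Lemma generated m p : exists2 c : {poly {poly C}},
  (size c <= r)%N & forall j, J (m + j) (n ^+ j * p) = moment c j.
Proof.
pose G m p := exists2 c : {poly {poly C}},
  (size c <= r)%N & forall j, J (m + j) (n ^+ j * p) = moment c j.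
have GD m' p1 p2 : G m' p1 -> G m' p2 -> G m' (p1 + p2).
  move=> [c1 s1 e1] [c2 s2 e2]; exists (c1 + c2) => [|j].
    by rewrite (leq_trans (size_polyD _ _)) // geq_max s1.
  by rewrite mulrDr JD e1 e2 momentD.
have Gn m' p' : G m' p' -> G m'.+1 (n * p').
  move=> [c s e]; exists ('X *: c) => [|j].
    exact: leq_trans (size_scale_leq _ _) s.
  by rewrite momentXZ -e mulrA -exprSr addSnnS.
have Gd m' p' : G m' p' -> G m'.+1 (p' * d).
  by move=> [c s e]; exists c => // j; rewrite mulrA addSn J_den.
have Gs s : (size s <= r)%N -> G 1%N s.
  move=> sr; exists (map_poly polyC s) => [|j].
    exact: leq_trans (size_poly _ _) sr.
  rewrite -{1}(coefK s) poly_def mulr_sumr J_sum.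
  rewrite (big_ord_widen r (fun i => J (1 + j) (n ^+ j * (s`_i *: 'X^i)))) //.
  rewrite big_mkcond; apply: eq_bigr => i _.
  rewrite coef_map /= coef_pairingC addn0 -scalerAr JZ.
  by case: ltnP => // si; rewrite nth_default // mul0r.
have G1 : forall p, G 1%N p.
  move=> p0; have [k] := ubnP (size p0); elim: k p0 => // k IH p0 sp0.
  have [p0r|rp0] := leqP (size p0) r; first exact: Gs.
  (* For the quotient [h], the fraction [n h / d] is [n / d] times [(h d) / d], and [h d] is smaller
     than [p0] because [deg d < deg n]. *)
  rewrite (divp_eq p0 n); apply: GD; last first.
    by apply: Gs; rewrite -ltnS -size_nE ltn_modp n_neq0.
  have p0N0 : p0 != 0 by rewrite -size_poly_gt0 (leq_ltn_trans _ rp0).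
  rewrite mulrC; apply: Gn.
  suff [c s e] : G 1%N (p0 %/ n * d) by exists c => // j; rewrite -e mulrA J_den.
  apply: IH; rewrite -ltnS; apply: leq_trans sp0; rewrite ltnS.
  rewrite (leq_ltn_trans (size_polyMleq _ _)) // size_divp ?n_neq0 // -/r.
  move: size_dn; rewrite size_nE; move: (size d) (size p0) rp0 => x y; lia.
have GS m' : forall p, G m'.+1 p.
  elim: m' => // m' IH p'.
  have cop : coprimep n (d ^+ m'.+1) by rewrite coprimep_expr.
  have [[g s] /=] := Bezout_eq1_coprimepP _ _ cop => e.
  (* By Bezout, [p'] is a multiple of [n], which lowers the exponent of the denominator after
     extracting [n / d], plus a term whose fraction reduces to denominator [d]. *)
  have -> : p' = n * (p' * g + (p' * s %/ n) * d ^+ m'.+1) + (p' * s %% n) * d ^+ m'.+1.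
    rewrite -{1}[p']mulr1 -e mulrDr [p' * (s * _)]mulrA {1}(divp_eq (p' * s) n).
    move: (_ %/ _) (_ %% _) (d ^+ _) => h t D; ring.
  apply: GD; first exact: Gn.
  have : G 1%N (p' * s %% n) by apply: Gs; rewrite -ltnS -size_nE ltn_modp n_neq0.
  move: (_ %% _) => s' Gs'; elim: m'.+1 => [|k]; first by rewrite mulr1.
  by move=> /Gd; rewrite -mulrA -exprSr.
case: m => [|m]; last exact: GS.
by have [c s e] := GS 0%N (p * d); exists c => // j; rewrite -e mulrA J_den.
Qed.


Let vanishing m p := forall i, J (m + i.+1) (n ^+ i.+1 * p) = 0.

Lemma vanishing_linear m a p q :
  vanishing m p -> vanishing m q -> vanishing m (a *: p + q).
Proof.
by move=> hp hq i; rewrite mulrDr -scalerAr J_linear hp hq mulr0 addr0.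
Qed.

Lemma vanishing_den m p : vanishing m p -> vanishing m.+1 (p * d).
Proof. by move=> hp i; rewrite mulrA addSn J_den hp. Qed.

Lemma vanishing_denX m p k : vanishing m p -> vanishing (m + k) (p * d ^+ k).
Proof.
move=> hp; elim: k => [|k IH]; first by rewrite addn0 expr0 mulr1.
by rewrite addnS exprSr mulrA; apply: vanishing_den.
Qed.

Lemma vanishing_num m p : vanishing m p -> vanishing m.+1 (n * p).
Proof. by move=> hp i; rewrite mulrA -exprSr addSnnS hp. Qed.

(** Over the new denominator, each factor is [x - c] with [x = n / d], and polynomials in [x]
    preserve the condition. *)
Lemma vanishing_prod m p (cs : seq C) : vanishing m p ->
  vanishing (m + size cs) (\prod_(c <- cs) (n - c *: d) * p).
Proof.
move=> hp; elim: cs => [|c cs IH]; first by rewrite addn0 big_nil mul1r.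
rewrite big_cons addnS -mulrA mulrBl; move: (_ * p) IH => q hq.
rewrite addrC -scalerAl -scaleNr [d * q]mulrC.
by apply: vanishing_linear; [exact: vanishing_den | exact: vanishing_num].
Qed.

(** * Raising the order of vanishing with [D - lambda] *)

Section Lifting.
Variables (eps : {poly C}) (cs : seq C) (K t : nat).
Hypothesis tE : t.+1 = (size cs + K)%N.
Hypothesis epsE : (n^`() * d - n * d^`()) * eps =
  n * (\prod_(c <- cs) (n - c *: d) * d ^+ K).
Hypothesis eps_z1 : eps.[z1] = 0.
Hypothesis eps_z2 : eps.[z2] = 0.
Hypothesis eps_root : forall z, root n z -> root eps z.
Hypothesis eps_simple : forall z, root n z -> eps^`().[z] != 0.

(* The numerator, over [d ^+ (m + t).+1], of the derivative of
   [(eps / d ^+ t) * (p / d ^+ m)]. *)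
Let D m p := (eps * p)^`() * d - (eps * p * d^`()) *+ (m + t).

Lemma J_D m p : J (m + t).+1 (D m p) = 0.
Proof. by apply: J_exact; rewrite hornerM ?eps_z1 ?eps_z2 mul0r. Qed.

(** The rule [D(x^i y) = x^i D y + i a(x) x^i y], cleared of denominators; by [epsE] and [tE], [a]
    is the product of the ['X - c] for [c] in [cs]. *)
Lemma D_num m p i : n ^+ i.+1 * D m p =
  D (m + i.+1) (n ^+ i.+1 * p) -
  (n ^+ i.+1 * (\prod_(c <- cs) (n - c *: d) * p * d ^+ K)) *+ i.+1.
Proof.
have -> : n ^+ i.+1 * (\prod_(c <- cs) (n - c *: d) * p * d ^+ K) =
    n ^+ i * ((n^`() * d - n * d^`()) * eps) * p.
  by rewrite epsE exprS; ring.
rewrite /D !derivM deriv_exp exprSr /=; ring.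
Qed.

(** In [D_num], the first term is exact and integrates to zero by [J_D]; the second is a multiple of
    [a(x) x^i y], covered by [vanishing_prod]. *)
Lemma vanishing_D m p : vanishing m p -> vanishing (m + t).+1 (D m p).
Proof.
move=> hp i; rewrite D_num JB JMn.
rewrite [X in J X (D _ _)](_ : _ = (m + i.+1 + t).+1) ?J_D; last by lia.
have := vanishing_denX K (vanishing_prod cs hp) i.
rewrite (_ : (m + size cs + K + i.+1)%N = ((m + t).+1 + i.+1)%N); last by lia.
by move=> ->; rewrite mul0rn subr0.
Qed.

(** Here [kappa] is the sum of the quotients [eps / ('X - x)] for [x] in [zs]. At [z], a quotient
    takes the value [eps'(z)] if [x = z] and 0 otherwise, so [M] counts the occurrences of [z]. *)
Lemma log_derivative (zs : seq C) : all (root n) zs ->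
  exists2 kappa : {poly C},
    (\prod_(z <- zs) ('X - z%:P))^`() * eps = \prod_(z <- zs) ('X - z%:P) * kappa &
    forall z, root n z -> exists M : nat, kappa.[z] = M%:R * eps^`().[z].
Proof.
elim: zs => [_|x zs IH /= /andP[nx /IH[kappa kappaE kappaz]]].
  exists 0; first by rewrite big_nil derivC mul0r mulr0.
  by move=> z _; exists 0%N; rewrite horner0 mul0r.
have /factor_theorem[rho rhoE] := eps_root nx.
exists (rho + kappa) => [|z nz].
  rewrite big_cons derivM derivXsubC mul1r mulrDl -mulrA kappaE rhoE; ring.
have [M kz] := kappaz z nz.
have [zx|zx] := eqVneq z x.
  exists M.+1; rewrite hornerD kz {1}rhoE derivM derivXsubC mulr1 hornerD hornerM.
  by rewrite hornerXsubC zx subrr mulr0 add0r rhoE derivM derivXsubC mulr1 hornerD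
    hornerM hornerXsubC subrr mulr0 add0r -natr1; ring.
exists M; rewrite hornerD kz.
have := eps_root nz; rewrite rhoE rootM root_XsubC (negPf zx) orbF.
by rewrite rootE => /eqP ->; rewrite add0r.
Qed.

(** Each root of the list costs one application of [D - lambda], which multiplies the integral by
    the nonzero number [- lambda]. *)
Lemma vanish_on_roots k u (zs : seq C) : all (root n) zs ->
    J k u != 0 -> vanishing k u ->
  exists m p, [/\ J m p != 0, vanishing m p & \prod_(z <- zs) ('X - z%:P) %| p].
Proof.
move=> + Ju0 Ju; elim: zs => [_|x zs IH /= /andP[nx nzs]].
  by exists k, u; rewrite big_nil dvd1p.
have [m [p [Jp0 Jp /dvdpP[v pE]]]] := IH nzs.
have [kappa kappaE kappaz] := log_derivative nzs.
move: pE kappaE; set S := \prod_(z <- zs) _ => pE kappaE.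
have [M kx] := kappaz x nx.
have dx : d.[x] != 0.
  by have := coprimep_root nd_coprime nx.
(* This is [(M + 1) eta'(x)] for [eta = eps / d^t], since [eps(x) = 0]; it is the value that makes
   the cofactor [e] below vanish at [x]. *)
pose lambda := M.+1%:R * eps^`().[x] / d.[x] ^+ t.
have lambda0 : lambda != 0.
  by rewrite !mulf_neq0 ?invr_eq0 ?expf_neq0 ?eps_simple // pnatr_eq0.
exists (m + t).+1, (- lambda *: (p * d ^+ t.+1) + D m p); split.
- by rewrite J_linear J_D addr0 -addnS J_denX mulf_neq0 // oppr_eq0.
- apply: vanishing_linear; last exact: vanishing_D.
  by rewrite -addnS; apply: vanishing_denX.
rewrite big_cons -/S.
pose e := eps^`() * v * d + eps * v^`() * d + kappa * v * d
   - (eps * v * d^`()) *+ (m + t) - lambda *: (v * d ^+ t.+1).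
have -> : - lambda *: (p * d ^+ t.+1) + D m p = S * e.
  rewrite /D /e pE !derivM -!mul_polyC polyCN.
  have -> : (eps^`() * (v * S) + eps * (v^`() * S + v * S^`())) * d =
     (eps^`() * v * S + eps * v^`() * S + v * (S^`() * eps)) * d by ring.
  by rewrite kappaE; ring.
rewrite mulrC dvdp_mul // dvdp_XsubCl rootE; apply/eqP.
have epsx : eps.[x] = 0 by apply/eqP/eps_root.
rewrite /e !(hornerD, hornerN, hornerM, hornerMn, hornerZ, horner_exp) kx epsx.
rewrite !mul0r mul0rn addr0 subr0 /lambda -natr1 exprS; field.
by rewrite expf_neq0.
Qed.

Lemma moment_eq0 k u : vanishing k u -> J k u = 0.
Proof.
move=> Ju; apply/eqP; apply: contraT => Ju0.
have [N0 stat] := moment_stationary.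
have [zs nE] := closed_field_poly_normal n.
have nzs : all (root n) zs.
  apply/allP => z zzs; rewrite nE rootZ ?lead_coef_eq0 ?n_neq0 //.
  by rewrite root_prod_XsubC.
(* Listing all zeros of [n], [N0] times each, makes [n^N0] divide [p]. *)
have [|m [p [Jp0 Jp]]] := @vanish_on_roots k u (flatten (nseq N0 zs)) _ Ju0 Ju.
  by apply/allP => z /flattenP[s /nseqP[-> _]]; move/allP: nzs; apply.
have -> : \prod_(z <- flatten (nseq N0 zs)) ('X - z%:P) =
    (\prod_(z <- zs) ('X - z%:P)) ^+ N0.
  by elim: N0 {stat Jp} => [|N IH]; rewrite ?big_nil ?expr0 //= big_cat IH exprS.
rewrite -(@dvdpZl _ (lead_coef n ^+ N0)) ?expf_neq0 ?lead_coef_eq0 ?n_neq0 //.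
rewrite -exprZn -nE => /dvdpP[v pE].
(* For [f = v d^N0 / d^m], the product [(n / d)^N0 f] is [p / d^m]: the moment of [c] of index [N0]
   is nonzero and all later ones vanish, against the choice of [N0]. *)
have [c sc cE] := generated m (v * d ^+ N0).
have vE j : n ^+ (N0 + j) * (v * d ^+ N0) = n ^+ j * p * d ^+ N0.
  by rewrite pE exprD; ring.
have := stat c N0.+1 sc _ N0 (leqnn _); rewrite -cE.
rewrite -[N0 in n ^+ N0]addn0 vE expr0 mul1r J_denX => Jp1.
rewrite Jp1 ?eqxx // in Jp0 => j Nj.
rewrite -cE -(subnKC (ltnW Nj)) vE addnCA addnC J_denX.
by rewrite -[(j - N0)%N]prednK ?subn_gt0 // Jp.
Qed.

End Lifting.

Lemma power_moment_eq0 k u :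
  (forall i, J (k + i.+1) (n ^+ i.+1 * u) = 0) -> J k u = 0.
Proof.
have [eps [cs [K [t [tE epsE /rootP e1 /rootP e2 er]]]]] :=
  simple_vector_field nd_coprime size_dn dz1 dz2.
by apply: (moment_eq0 tE epsE e1 e2) => z /er[].
Qed.

End Moments.

(** * Integration along curves *)

Section ContinuouslyDifferentiable.
Variable R : realType.
Implicit Types (a b t : R) (f g : R -> R) (n : nat).
Local Notation mu := (@lebesgue_measure R).

Definition continuous_on a b f := {within `[a, b], continuous f}.

Lemma continuous_onP a b f : continuous_on a b f <->
  forall t, t \in `[a, b] -> f @ within `[a, b] (nbhs t) --> f t.
Proof.
split=> [/subspace_continuousP cf t tab|cf]; first exact: cf.
by apply/subspace_continuousP => t; apply: cf.
Qed.

(** At the end points, [f'] is only a continuous extension of the derivative, as for the velocity of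
    an arc between two corners. *)
Definition c1 a b f f' := [/\ {in `]a, b[, forall t, is_derive t 1 f (f' t)},
  continuous_on a b f & continuous_on a b f'].

Lemma continuous_on_cst a b (k : R) : continuous_on a b (fun=> k).
Proof. by apply/continuous_onP => t _; exact: cvg_cst. Qed.

Lemma continuous_onD a b f g : continuous_on a b f -> continuous_on a b g ->
  continuous_on a b (fun t => f t + g t).
Proof.
move=> /continuous_onP cf /continuous_onP cg; apply/continuous_onP => t tab.
exact: cvgD (cf _ tab) (cg _ tab).
Qed.

Lemma continuous_onN a b f : continuous_on a b f -> continuous_on a b (fun t => - f t).
Proof.
move=> /continuous_onP cf; apply/continuous_onP => t tab; exact: cvgN (cf _ tab).
Qed.

Lemma continuous_onM a b f g : continuous_on a b f -> continuous_on a b g ->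
  continuous_on a b (fun t => f t * g t).
Proof.
move=> /continuous_onP cf /continuous_onP cg; apply/continuous_onP => t tab.
exact: cvgM (cf _ tab) (cg _ tab).
Qed.

Lemma continuous_onV a b f : continuous_on a b f ->
  (forall t, t \in `[a, b] -> f t != 0) -> continuous_on a b (fun t => (f t)^-1).
Proof.
move=> /continuous_onP cf f0; apply/continuous_onP => t tab.
exact: cvgV (f0 _ tab) (cf _ tab).
Qed.

Lemma c1_cst a b (k : R) : c1 a b (fun=> k) (fun=> 0).
Proof. by split; [move=> t _; exact: is_derive_cst|exact: continuous_on_cst..]. Qed.

Lemma c1D a b f f' g g' : c1 a b f f' -> c1 a b g g' ->
  c1 a b (fun t => f t + g t) (fun t => f' t + g' t).
Proof.
move=> [df cf cf'] [dg cg cg']; split; try exact: continuous_onD.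
by move=> t tab; have := df t tab; have := dg t tab => *; exact: is_deriveD.
Qed.

Lemma c1N a b f f' : c1 a b f f' -> c1 a b (fun t => - f t) (fun t => - f' t).
Proof.
move=> [df cf cf']; split; try exact: continuous_onN.
by move=> t tab; have := df t tab => *; exact: is_deriveN.
Qed.

Lemma c1M a b f f' g g' : c1 a b f f' -> c1 a b g g' ->
  c1 a b (fun t => f t * g t) (fun t => f' t * g t + f t * g' t).
Proof.
move=> [df cf cf'] [dg cg cg']; split.
- move=> t tab; have := df t tab; have := dg t tab => *.
  by apply: is_derive_eq; rewrite /GRing.scale /=; ring.
- exact: continuous_onM.
- by apply: continuous_onD; exact: continuous_onM.
Qed.

Lemma c1V a b f f' : c1 a b f f' -> (forall t, t \in `[a, b] -> f t != 0) ->
  c1 a b (fun t => (f t)^-1) (fun t => - ((f t)^-1 * (f t)^-1 * f' t)).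
Proof.
move=> [df cf cf'] f0; have cV := continuous_onV cf f0; split=> //.
- move=> t tab; have := df t tab => ?.
  have ft0 : f t != 0 by apply/f0/subset_itv_oo_cc.
  by apply: is_derive_eq (is_deriveV ft0 _) _; rewrite /GRing.scale /=; field.
- by apply/continuous_onN/continuous_onM => //; exact: continuous_onM.
Qed.

Lemma eq_c1 a b f f' g g' : f =1 g -> {in `[a, b], f' =1 g'} ->
  c1 a b f f' -> c1 a b g g'.
Proof.
move=> /funext -> fg' [dg cg cf']; split=> //.
  by move=> t tab; rewrite -fg' ?subset_itv_oo_cc //; exact: dg.
by apply: subspace_eq_continuous cf' => t; rewrite inE => /fg'.
Qed.

Lemma c1_LRcontinuous a b f f' : a < b ->
    derivable_oo_LRcontinuous f a b -> {in `]a, b[, derive1 f =1 f'} ->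
  continuous_on a b f' -> c1 a b f f'.
Proof.
move=> ab df f'E cf'; split=> //; last exact: derivable_oo_LRcontinuous_within.
move=> t tab; rewrite -f'E // derive1E; apply: DeriveDef => //.
by case: df => df _ _; exact: df.
Qed.

Lemma c1_integral a b f f' : a < b -> c1 a b f f' ->
  \int[mu]_(t in `[a, b]) f' t = f b - f a.
Proof.
move=> ab [df cf cf']; rewrite /Rintegral (@continuous_FTC2 _ f' f) //.
  have /(continuous_within_itvP _ ab)[_ fa fb] := cf.
  by split=> // t /df [].
by move=> t tab; rewrite derive1E; have [_ ->] := df t tab.
Qed.

Lemma integrable_itv_oocc a b (f : R -> R) :
  mu.-integrable `]a, b[ (EFin \o f) -> mu.-integrable `[a, b] (EFin \o f).
Proof.
move=> /integrableP[mf fi]; apply/integrableP; split.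
  exact: emeasurable_fun_itv_cc mf.
by rewrite integral_itv_bndoo //; exact: (@measurableT_comp _ _ _ _ _ _ abse).
Qed.

(** Serves to replace the velocity, arbitrary at corners, by its continuous extension: the end
    points are negligible. *)
Lemma eq_oo_integrable a b (f g : R -> R) : {in `]a, b[, f =1 g} ->
  continuous_on a b g -> mu.-integrable `[a, b] (EFin \o f).
Proof.
move=> fg cg; apply: integrable_itv_oocc.
apply: (@eq_integrable _ _ _ mu _ _ (EFin \o g)) => //.
  by move=> t; rewrite inE /= => tab; rewrite fg.
have ig : mu.-integrable `[a, b] (EFin \o g).
  by apply: continuous_compact_integrable => //; exact: segment_compact.
by apply: integrableS ig => //; exact: subset_itv_oo_cc.
Qed.

Lemma eq_oo_Rintegral a b (f g : R -> R) : {in `]a, b[, f =1 g} ->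
    continuous_on a b g ->
  \int[mu]_(t in `[a, b]) f t = \int[mu]_(t in `[a, b]) g t.
Proof.
move=> fg cg.
have ooE (h : R -> R) : mu.-integrable `[a, b] (EFin \o h) ->
    \int[mu]_(t in `[a, b]) h t = \int[mu]_(t in `]a, b[) h t.
  move=> /integrableP[mh _]; rewrite /Rintegral integral_itv_bndoo //.
  by apply: measurable_funS mh => //; exact: subset_itv_oo_cc.
rewrite !ooE; first by apply: eq_Rintegral => t; rewrite inE /= => /fg.
  exact: eq_oo_integrable cg.
exact: eq_oo_integrable fg cg.
Qed.

Lemma subdivision_le n (x : nat -> R) : (forall k, (k < n)%N -> x k < x k.+1) ->
  x 0%N <= x n.
Proof.
elim: n => // n IH h; apply: le_trans (ltW (h n _)) => //.
by apply: IH => k kn; apply: h; exact: ltnW.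
Qed.

Lemma itv_cc_oc a b c : a <= b -> b <= c ->
  `[a, c]%classic = `[a, b] `|` `]b, c] :> set R.
Proof. by move=> ab bc; rewrite -itv_bndbnd_setU // bnd_simp. Qed.

Lemma piecewise_integrable (f : R -> R) n (x : nat -> R) :
    (forall k, (k < n)%N -> x k < x k.+1) ->
    (forall k, (k < n)%N -> mu.-integrable `[x k, x k.+1] (EFin \o f)) ->
  mu.-integrable `[x 0%N, x n] (EFin \o f).
Proof.
elim: n => [_ _|n IH xlt fi].
  rewrite set_itv1; apply: null_set_integrable => //; last exact: lebesgue_measure_set1.
  exact: measurable_fun_set1.
have xlt' k : (k < n)%N -> x k < x k.+1 by move=> kn; apply: xlt; exact: ltnW.
rewrite (itv_cc_oc (subdivision_le xlt') (ltW (xlt n _))) //.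
have /integrableP[mA iA] : mu.-integrable `[x 0%N, x n] (EFin \o f).
  by apply: IH => // k kn; apply: fi; exact: ltnW.
have /integrableP[mB iB] : mu.-integrable `]x n, x n.+1] (EFin \o f).
  apply: integrableS (fi n (ltnSn n)) => //; exact: subset_itv_oc_cc.
have mAB : measurable_fun (`[x 0%N, x n] `|` `]x n, x n.+1]) (EFin \o f).
  exact/measurable_funU.
apply/integrableP; split=> //.
rewrite ge0_integral_setU //; first exact: lte_add_pinfty.
  exact: (@measurableT_comp _ _ _ _ _ _ abse).
apply/disj_setPS => y [/=]; rewrite 2!in_itv/= => /andP[_ yx] /andP[].
by rewrite ltNge yx.
Qed.

Lemma piecewise_Rintegral (f F : R -> R) n (x : nat -> R) :
    (forall k, (k < n)%N -> x k < x k.+1) ->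
    (forall k, (k < n)%N -> mu.-integrable `[x k, x k.+1] (EFin \o f)) ->
    (forall k, (k < n)%N -> \int[mu]_(t in `[x k, x k.+1]) f t = F (x k.+1) - F (x k)) ->
  \int[mu]_(t in `[x 0%N, x n]) f t = F (x n) - F (x 0%N).
Proof.
elim: n => [_ _ _|n IH xlt fi fE].
  by rewrite set_itv1 Rintegral_set1 subrr.
have xlt' k : (k < n)%N -> x k < x k.+1 by move=> kn; apply: xlt; exact: ltnW.
have x0n := subdivision_le xlt'; have xnn := ltW (xlt n (ltnSn n)).
have fin : mu.-integrable `[x 0%N, x n.+1] (EFin \o f) by exact: piecewise_integrable.
rewrite (itv_cc_oc x0n xnn) Rintegral_setU //; last 2 first.
- by rewrite -(itv_cc_oc x0n xnn).
- apply/disj_setPS => y [/=]; rewrite 2!in_itv/= => /andP[_ yx] /andP[].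
  by rewrite ltNge yx.
rewrite IH //; try by move=> k kn; (apply: fi || apply: fE); exact: ltnW.
rewrite Rintegral_itv_obnd_cbnd ?fE //; first by rewrite addrC subrKA.
apply: integrableS (fi n (ltnSn n)) => //; exact: subset_itv_oc_cc.
Qed.

End ContinuouslyDifferentiable.

(** * Complex-valued functions along a curve, and contour integrals *)

Section ComplexCurves.
Variable R : realType.
Implicit Types (a b t : R) (f g w : R -> R[i]) (p d : {poly R[i]}) (x y : R[i]).
Local Notation mu := (@lebesgue_measure R).
Local Notation Re := complex.Re.
Local Notation Im := complex.Im.

Lemma ReD x y : Re (x + y) = Re x + Re y. Proof. by case: x y => [? ?] []. Qed.
Lemma ImD x y : Im (x + y) = Im x + Im y. Proof. by case: x y => [? ?] []. Qed.
Lemma ReM x y : Re (x * y) = Re x * Re y - Im x * Im y.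
Proof. by case: x y => [? ?] []. Qed.
Lemma ImM x y : Im (x * y) = Re x * Im y + Im x * Re y.
Proof. by case: x y => [? ?] []. Qed.
Lemma ReV x : Re x^-1 = Re x * (Re x ^+ 2 + Im x ^+ 2)^-1. Proof. by case: x. Qed.
Lemma ImV x : Im x^-1 = - (Im x * (Re x ^+ 2 + Im x ^+ 2)^-1). Proof. by case: x. Qed.

Lemma norm2_neq0 x : x != 0 -> Re x ^+ 2 + Im x ^+ 2 != 0.
Proof.
by case: x => u v; rewrite eq_complex /= paddr_eq0 ?sqr_ge0 // !expf_eq0.
Qed.

Definition complex_c1 a b f f' :=
  c1 a b (fun t => Re (f t)) (fun t => Re (f' t)) /\
  c1 a b (fun t => Im (f t)) (fun t => Im (f' t)).

Lemma eq_complex_c1 a b f g f' g' : f =1 g -> {in `[a, b], f' =1 g'} ->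
  complex_c1 a b f f' -> complex_c1 a b g g'.
Proof.
move=> fg fg' [rf jf]; split; [apply: eq_c1 rf|apply: eq_c1 jf] => t;
  by rewrite ?fg // => /fg' ->.
Qed.

Lemma complex_c1_cst a b x : complex_c1 a b (fun=> x) (fun=> 0).
Proof. by split; exact: c1_cst. Qed.

Lemma complex_c1D a b f f' g g' : complex_c1 a b f f' -> complex_c1 a b g g' ->
  complex_c1 a b (fun t => f t + g t) (fun t => f' t + g' t).
Proof.
move=> [rf jf] [rg jg]; split; [have := c1D rf rg|have := c1D jf jg];
  by apply: eq_c1 => [t|t _]; rewrite ?ReD ?ImD.
Qed.

Lemma complex_c1M a b f f' g g' : complex_c1 a b f f' -> complex_c1 a b g g' ->
  complex_c1 a b (fun t => f t * g t) (fun t => f' t * g t + f t * g' t).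
Proof.
move=> [rf jf] [rg jg]; split.
  have := c1D (c1M rf rg) (c1N (c1M jf jg)).
  by apply: eq_c1 => [t|t _]; rewrite ?ReD !ReM //; ring.
have := c1D (c1M rf jg) (c1M jf rg).
by apply: eq_c1 => [t|t _]; rewrite ?ImD !ImM //; ring.
Qed.

(** The inverse is the conjugate divided by the squared modulus, a nonvanishing real function of
    class C^1. *)
Lemma complex_c1V a b f f' : complex_c1 a b f f' ->
    (forall t, t \in `[a, b] -> f t != 0) ->
  complex_c1 a b (fun t => (f t)^-1) (fun t => - ((f t)^-1 * (f t)^-1 * f' t)).
Proof.
move=> [rf jf] f0.
have norm0 t : t \in `[a, b] -> Re (f t) * Re (f t) + Im (f t) * Im (f t) != 0.
  by move=> /f0 /norm2_neq0; rewrite !expr2.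
have nV := c1V (c1D (c1M rf rf) (c1M jf jf)) norm0.
split; [have := c1M rf nV|have := c1N (c1M jf nV)]; apply: eq_c1 => t.
- by rewrite ReV !expr2.
- move=> /norm0; rewrite -[- (_ * f' t)]mulN1r !ReM !ImM ReV ImV !expr2 /=.
  move: (Re (f t)) (Im (f t)) (Re (f' t)) (Im (f' t)) => u v u' v' n0; field.
  by [].
- by rewrite ImV !expr2.
- move=> /norm0; rewrite -[- (_ * f' t)]mulN1r !ImM !ReM ReV ImV !expr2 /=.
  move: (Re (f t)) (Im (f t)) (Re (f' t)) (Im (f' t)) => u v u' v' n0; field.
  by [].
Qed.

Lemma complex_c1_horner a b p g w : complex_c1 a b g w ->
  complex_c1 a b (fun t => p.[g t]) (fun t => p^`().[g t] * w t).
Proof.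
move=> gw; elim/poly_ind: p => [|p c IH].
  apply: eq_complex_c1 (complex_c1_cst a b 0) => [t|t _]; first by rewrite horner0.
  by rewrite deriv0 horner0 mul0r.
apply: eq_complex_c1 (complex_c1D (complex_c1M IH gw) (complex_c1_cst a b c)) => [t|t _].
  by rewrite hornerMXaddC.
by rewrite derivMXaddC hornerD hornerMX; ring.
Qed.

Lemma complex_c1_ratio a b p d g w m : complex_c1 a b g w ->
    (forall t, t \in `[a, b] -> d.[g t] != 0) ->
  complex_c1 a b (fun t => p.[g t] / d.[g t] ^+ m)
   (fun t => (p^`() * d - (p * d^`()) *+ m).[g t] / d.[g t] ^+ m.+1 * w t).
Proof.
move=> gw d0.
have dm0 t : t \in `[a, b] -> (d ^+ m).[g t] != 0.
  by move=> /d0 ?; rewrite horner_exp expf_neq0.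
have := complex_c1M (complex_c1_horner p gw)
  (complex_c1V (complex_c1_horner (d ^+ m) gw) dm0).
apply: eq_complex_c1 => t; first by rewrite horner_exp.
move=> /d0 dt0; rewrite deriv_exp !(hornerD, hornerN, hornerM, hornerMn, horner_exp).
(* The exponent [m.-1] in the derivative of [d ^+ m] is truncated at [m = 0], hence the separate
   case. *)
case: m {dm0} => [|m] /=; first by rewrite !mulr0n expr0 expr1 invr1; field.
have := expf_neq0 m dt0; rewrite !exprS; move: (d.[g t] ^+ m) => e e0.
by field; rewrite e0 dt0.
Qed.

Lemma complex_continuousM a b f g :
  continuous_on a b (fun t => Re (f t)) -> continuous_on a b (fun t => Im (f t)) ->
  continuous_on a b (fun t => Re (g t)) -> continuous_on a b (fun t => Im (g t)) ->
  continuous_on a b (fun t => Re (f t * g t)) /\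
  continuous_on a b (fun t => Im (f t * g t)).
Proof.
move=> rf jf rg jg.
rewrite (_ : (fun t => Re (f t * g t)) =
    fun t => Re (f t) * Re (g t) + - (Im (f t) * Im (g t))); last first.
  by apply/funext => t; rewrite ReM.
rewrite (_ : (fun t => Im (f t * g t)) =
    fun t => Re (f t) * Im (g t) + Im (f t) * Re (g t)); last first.
  by apply/funext => t; rewrite ImM.
split; apply: continuous_onD; do ?apply: continuous_onN; exact: continuous_onM.
Qed.

Lemma smooth_arc_c1 a b g : a < b -> smooth_arc g a b ->
  exists2 w, complex_c1 a b g w & {in `]a, b[, velocity g =1 w}.
Proof.
move=> ab [dr di [w [cr ci wE _]]]; exists w => //.
by split; apply: c1_LRcontinuous => // t /wE <-.
Qed.

Section Contour.
Variables (g : R -> R[i]) (a b : R).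
Hypothesis g_smooth : piecewise_smooth g a b.

Let subinterval n (x : nat -> R) k t : x 0%N = a -> x n = b ->
  (forall k, (k < n)%N -> x k < x k.+1) -> (k < n)%N ->
  t \in `[x k, x k.+1] -> t \in `[a, b].
Proof.
move=> xa xb xlt kn; rewrite !in_itv /= => /andP[xkt txk]; apply/andP; split.
  apply: le_trans xkt; rewrite -xa; apply: subdivision_le => j jk.
  by apply: xlt; exact: ltn_trans kn.
apply: le_trans txk _; rewrite -xb.
have := @subdivision_le _ (n - k.+1) (fun j => x (k.+1 + j)%N).
rewrite addn0 subnKC //; apply => j jn; rewrite addnS; apply: xlt; lia.
Qed.

Variable d : {poly R[i]}.
Hypothesis g_d : forall t, t \in `[a, b] -> d.[g t] != 0.

Let J m p := contour_integral g a b (fun z => p.[z] / d.[z] ^+ m).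

Let integrand m p t := p.[g t] / d.[g t] ^+ m * velocity g t.

Let integrand_arc l r m p : l < r -> smooth_arc g l r ->
    (forall t, t \in `[l, r] -> t \in `[a, b]) ->
  exists2 w, complex_c1 l r g w &
    [/\ continuous_on l r (fun t => Re (p.[g t] / d.[g t] ^+ m * w t)),
      continuous_on l r (fun t => Im (p.[g t] / d.[g t] ^+ m * w t)) &
      {in `]l, r[, forall t, integrand m p t = p.[g t] / d.[g t] ^+ m * w t}].
Proof.
move=> lr /(smooth_arc_c1 lr)[w gw vE] lrab; exists w => //.
have d0 t : t \in `[l, r] -> d.[g t] != 0 by move=> /lrab /g_d.
have [[_ rF _] [_ jF _]] := complex_c1_ratio p m gw d0.
have [[_ _ rw] [_ _ jw]] := gw.
have [? ?] := complex_continuousM rF jF rw jw; split=> // t tlr.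
by rewrite /integrand vE.
Qed.

Lemma integrand_integrable m p :
  mu.-integrable `[a, b] (EFin \o (fun t => Re (integrand m p t))) /\
  mu.-integrable `[a, b] (EFin \o (fun t => Im (integrand m p t))).
Proof.
have [n [x [xa xb arcs]]] := g_smooth.
have xlt k (kn : (k < n)%N) : x k < x k.+1 by case: (arcs k kn).
rewrite -xa -xb; split; apply: piecewise_integrable => // k kn;
  have [w _ [cr ci wE]] := integrand_arc m p (xlt k kn) (proj2 (arcs k kn))
    (fun t => subinterval xa xb xlt kn).
- by apply: eq_oo_integrable cr => t /wE ->.
- by apply: eq_oo_integrable ci => t /wE ->.
Qed.

Lemma contour_integral_linear m x p q : J m (x *: p + q) = x * J m p + J m q.
Proof.
have [rp jp] := integrand_integrable m p; have [rq jq] := integrand_integrable m q.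
have intZ (h : R -> R) k : mu.-integrable `[a, b] (EFin \o h) ->
    mu.-integrable `[a, b] (EFin \o (fun t => k * h t)).
  by move=> ih; apply: (integrableZl _ k ih).
have intD (h1 h2 : R -> R) : mu.-integrable `[a, b] (EFin \o h1) ->
    mu.-integrable `[a, b] (EFin \o h2) ->
    mu.-integrable `[a, b] (EFin \o (fun t => h1 t + h2 t)).
  by move=> i1 i2; apply: (integrableD _ i1 i2).
have E t : integrand m (x *: p + q) t = x * integrand m p t + integrand m q t.
  by rewrite /integrand hornerD hornerZ; ring.
have mab : measurable (`[a, b]%classic : set R) by [].
apply/eqP; rewrite eq_complex; apply/andP; split; apply/eqP.
  rewrite ReD ReM /= -!RintegralZl // -RintegralB ?intZ // -RintegralD //; last first.
    by apply: (integrableB _ (intZ _ _ rp) (intZ _ _ jp)).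
  by apply: eq_Rintegral => t _; rewrite -[X in Re X]/(integrand _ _ t) E ReD ReM.
rewrite ImD ImM /= -!RintegralZl // -RintegralD ?intZ // -RintegralD //; last first.
  by apply: (intD _ _ (intZ _ _ jp) (intZ _ _ rp)).
by apply: eq_Rintegral => t _; rewrite -[X in Im X]/(integrand _ _ t) E ImD ImM.
Qed.

Lemma contour_integral_den m p : J m.+1 (p * d) = J m p.
Proof.
rewrite /J /contour_integral /complex_integral.
congr Complex; apply: eq_Rintegral => t; rewrite inE => /= tab;
  congr (_ (_ * _)); by rewrite hornerM exprS; field; rewrite expf_neq0 g_d.
Qed.

(** On each arc [p / d^m] is a primitive of the integrand; the sum over the arcs telescopes to its
    values at the end points, which are zero. *)
Lemma contour_integral_exact m p : p.[g a] = 0 -> p.[g b] = 0 ->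
  J m.+1 (p^`() * d - (p * d^`()) *+ m) = 0.
Proof.
move=> pa pb; have [n [x [xa xb arcs]]] := g_smooth.
have xlt k (kn : (k < n)%N) : x k < x k.+1 by case: (arcs k kn).
set q := p^`() * d - _.
have [rq jq] : (forall k, (k < n)%N ->
   mu.-integrable `[x k, x k.+1] (EFin \o (fun t => Re (integrand m.+1 q t)))) /\
  (forall k, (k < n)%N ->
   mu.-integrable `[x k, x k.+1] (EFin \o (fun t => Im (integrand m.+1 q t)))).
  have [rq jq] := integrand_integrable m.+1 q.
  split=> k kn; [apply: integrableS rq | apply: integrableS jq] => // t;
    exact: (subinterval xa xb xlt kn).
have F k (kn : (k < n)%N) :
    \int[mu]_(t in `[x k, x k.+1]) Re (integrand m.+1 q t) =
      Re (p.[g (x k.+1)] / d.[g (x k.+1)] ^+ m) - Re (p.[g (x k)] / d.[g (x k)] ^+ m) /\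
    \int[mu]_(t in `[x k, x k.+1]) Im (integrand m.+1 q t) =
      Im (p.[g (x k.+1)] / d.[g (x k.+1)] ^+ m) - Im (p.[g (x k)] / d.[g (x k)] ^+ m).
  have sub := fun t => @subinterval _ _ _ t xa xb xlt kn.
  have [w gw [cr ci wE]] := integrand_arc m.+1 q (xlt k kn) (proj2 (arcs k kn)) sub.
  have d0 t : t \in `[x k, x k.+1] -> d.[g t] != 0 by move=> /sub /g_d.
  have [rF jF] := complex_c1_ratio p m gw d0; split.
    rewrite -(c1_integral (xlt k kn) rF); apply: eq_oo_Rintegral cr => t /wE -> //.
  rewrite -(c1_integral (xlt k kn) jF); apply: eq_oo_Rintegral ci => t /wE -> //.
apply/eqP; rewrite eq_complex; apply/andP; split; apply/eqP => /=.
  rewrite -xa -xb (piecewise_Rintegral (F := fun t => Re (p.[g t] / d.[g t] ^+ m)) xlt rq).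
    by rewrite xa xb pa pb !mul0r subrr.
  by move=> k /F[].
rewrite -xa -xb (piecewise_Rintegral (F := fun t => Im (p.[g t] / d.[g t] ^+ m)) xlt jq).
  by rewrite xa xb pa pb !mul0r subrr.
by move=> k /F[].
Qed.

End Contour.
End ComplexCurves.

(** * Reduction of the theorem to numerators over powers of [d] *)

Lemma dvdp_exp_roots (F : closedFieldType) (p d : {poly F}) : p != 0 ->
  (forall z, root p z -> root d z) -> exists k, p %| d ^+ k.
Proof.
move=> p0 pd; have [zs pE] := closed_field_poly_normal p.
have {pd} : all (root d) zs.
  apply/allP => z zzs; apply: pd.
  by rewrite pE rootZ ?lead_coef_eq0 // root_prod_XsubC.
move=> zsd; exists (size zs); rewrite pE dvdpZl ?lead_coef_eq0 //.
elim: zs zsd {pE} => [_|z zs IH /= /andP[dz /IH dv]]; first by rewrite big_nil dvd1p.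
by rewrite big_cons exprS dvdp_mul // dvdp_XsubCl.
Qed.

Section Ratfun.
Variables (R : realType) (f : ratfun R).

Lemma rden_neq0 : rden f != 0.
Proof. by rewrite dvdp_div_eq0 ?dvdp_gcdr // denom_ratioP. Qed.

Lemma coprimep_rnum_rden : coprimep (rnum f) (rden f).
Proof. by apply: coprimep_div_gcd; rewrite denom_ratioP orbT. Qed.

End Ratfun.

Theorem corollary3p5 (R : realType) (P q : ratfun R)
  (P_nonconst : forall c : R[i], P <> tofrac (c%:P))
  (q_neq0 : q != 0)
  (gamma : R -> R[i]) (a b : R)
  (gamma_curve : is_curve gamma a b)
  (gamma_P : avoids_poles gamma a b P)
  (gamma_q : avoids_poles gamma a b q)
  (poles_sub : rat_eval q @^-1` [set infty] `<=` rat_eval P @^-1` [set infty])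
  (P_infty : rat_eval P infty = infty)
  (i0 : nat)
  (moments0 : forall i : nat, (i0 <= i)%N ->
    contour_integral gamma a b (fun z => rat_val P z ^+ i * rat_val q z) = 0) :
  forall i : nat,
    contour_integral gamma a b (fun z => rat_val P z ^+ i * rat_val q z) = 0.
Proof.
have pole (f : ratfun R) z : rat_eval f (Some z) = infty <-> root (rden f) z.
  by rewrite /rat_eval; case: ifP.
have val_ (f : ratfun R) z : ~~ root (rden f) z ->
    rat_val f z = (rnum f).[z] / (rden f).[z].
  by rewrite /rat_val /rat_eval => /negPf ->.
set n := rnum P; set d := rden P.
have size_dn : (size d < size n)%N.
  by move: P_infty; rewrite /rat_eval; case: ifP.
have gd t : t \in `[a, b] -> d.[gamma t] != 0.
  by move=> /gamma_P gt; apply/negP => /pole.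
(* Every finite pole of [q] is a pole of [P], so the denominator of [q] divides a power of [d], and
   [q = u / d^k]. *)
have [k [u uE]] : exists k u, rnum q * d ^+ k = u * rden q.
  have [|k] := @dvdp_exp_roots _ (rden q) d (rden_neq0 q).
    by move=> z /pole /poles_sub /pole.
  by move=> dk; exists k; apply/dvdpP; exact: dvdp_mull.
have gq t : t \in `[a, b] -> rat_val q (gamma t) = u.[gamma t] / d.[gamma t] ^+ k.
  move=> tab.
  have q0 : (rden q).[gamma t] != 0 by apply/negP => /pole; exact: gamma_q.
  rewrite val_ //; apply/eqP; rewrite eqr_div ?expf_neq0 ?gd //.
  by rewrite -horner_exp -!hornerM -uE.
case: gamma_curve => ab g_smooth _.
pose J m p := contour_integral gamma a b (fun z => p.[z] / d.[z] ^+ m).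
have momentE i : contour_integral gamma a b (fun z => rat_val P z ^+ i * rat_val q z) =
    J (k + i)%N (n ^+ i * u).
  rewrite /J /contour_integral /complex_integral.
  congr Complex; apply: eq_Rintegral => t; rewrite inE => /= tab;
    congr (_ (_ * _)); rewrite gq // val_ ?gd // hornerM horner_exp exprD expr_div_n;
    by field; rewrite !expf_neq0 ?gd.
have atab : a \in `[a, b] by rewrite in_itv /= lexx ltW.
have btab : b \in `[a, b] by rewrite in_itv /= lexx ltW.
(* This is [power_moment_eq0] for the fraction [P^i q], whose numerator is [n ^+ i * u] over
   [d ^+ (k + i)]. *)
have step i : (forall j, (i < j)%N -> J (k + j)%N (n ^+ j * u) = 0) ->
    J (k + i)%N (n ^+ i * u) = 0.
  move=> Ji.
  apply: (@power_moment_eq0 _ n d _ size_dn _ _ (gd a atab) (gd b btab) J).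
  - exact: coprimep_rnum_rden.
  - exact: contour_integral_linear.
  - exact: contour_integral_den.
  - exact: contour_integral_exact.
  move=> j; rewrite mulrA -exprD -addnA [(i + _)%N]addnC; apply: Ji; lia.
(* Descending induction from [i0], one exponent at a time; [l = i0] reaches every [i]. *)
have all0 l : forall i, (i0 - l <= i)%N -> J (k + i)%N (n ^+ i * u) = 0.
  elim: l => [|l IH] i il; first by rewrite -momentE moments0 // -(subn0 i0).
  by apply: step => j ij; apply: IH; lia.
by move=> i; rewrite momentE (all0 i0) // subnn.
Qed.
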